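(* The following connection formulas hold between the matrix Laurent polynomials associated with $\mu$ and with the Christoffel perturbed matrix of measures $\mathrm d\hat\mu(z)=W_{[q]}(z)\,\mathrm d\mu(z)$: $$\hat B(z)\,W_{[q]}(z)=N_C\,B(z),\qquad \hat B^{(b)}(z)=\frac{1}{W_b(z)}\,N_C\,B^{(b)}(z)\quad(b\in\{1,\dots,q\}),$$ $$\hat A(z^{-1})\,N_C=A(z^{-1}),\qquad \hat A^{(a)}(z^{-1})\,N_C=A^{(a)}(z^{-1})\quad(a\in\{1,\dots,p\}).$$
   Context: Let $p,q,d\in\mathbb N$ and let $\mu$ be a $q\times p$ matrix of complex Borel measures with infinite support on the unit circle $\mathbb T=\{|z|=1\}$. Rows and columns of semi-infinite matrices are indexed from $0$. For $r\in\mathbb N$, $Z_{[r]}(z)$ is the $\infty\times r$ matrix obtained by stacking the $r\times r$ blocks $I_r, z^{-1}I_r, zI_r, z^{-2}I_r, z^2I_r,\dots$ (block number $2N$ is $z^NI_r$, block number $2N+1$ is $z^{-N-1}I_r$). Let $W_{[q]}(z)=\mathrm{diag}(W_1(z),\dots,W_q(z))$, where each $W_b$ is a balanced Laurent polynomial $W_b(z)=c_bz^{-d}\prod_{\ell=1}^{2d}(z-z_{b,\ell})$, $c_b\neq0$, with $2d$ distinct nonzero zeros, the $2dq$ zeros $z_{b,\ell}$ being all different. The moment matrices are $M=\oint_{\mathbb T}Z_{[q]}(z)\,\mathrm d\mu(z)\,Z_{[p]}^\top(z^{-1})$ and $\hat M=\oint_{\mathbb T}Z_{[q]}(z)\,W_{[q]}(z)\,\mathrm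 d\mu(z)\,Z_{[p]}^\top(z^{-1})$. It is assumed that both have Gauss--Borel factorizations $M=L^{-1}U^{-1}$, $\hat M=\hat L^{-1}\hat U^{-1}$, with $L,\hat L$ lower triangular and $U,\hat U$ upper triangular semi-infinite matrices with nonzero diagonal entries. Put $B(z)=LZ_{[q]}(z)$, $A(z^{-1})=Z_{[p]}^\top(z^{-1})U$, $\hat B(z)=\hat LZ_{[q]}(z)$, $\hat A(z^{-1})=Z_{[p]}^\top(z^{-1})\hat U$; superscript $(b)$ denotes the $b$-th column of $B,\hat B$, and superscript $(a)$ denotes the $a$-th row of $A,\hat A$. $\Upsilon_{[q]}$ is the semi-infinite permutation matrix whose $q\times q$ blocks (block indices from $0$) are $I_q$ at block positions $(2k,2k+2)$, $k\ge0$, at $(1,0)$, and at $(2k+3,2k+1)$, $k\ge0$, and zero elsewhere. $I_{[q]}^{(b)}$ is the semi-infinite diagonal matrix with ones exactly at the diagonal positions $q\nu+b-1$, $\nu\in\mathbb N_0$. With $\Upsilon^{(b)}_{[q]}=\Upsilon_{[q]}I^{(b)}_{[q]}=I^{(b)}_{[q]}\Upsilon_{[q]}$, whose integer powers are understood as $(\Upsilon^{(b)}_{[q]})^k=\Upsilon_{[q]}^kI^{(b)}_{[q]}$, $k\in\mathbb Z$, set $\mathcal W=\sum_{b=1}^qW_b(\Upsilon_{[q]}^{(b)})$. One has $\hat M=\mathcal WM$, and the connection matrix is $N_C=\hat U^{-1}U=\hat L\,\mathcal W\,L^{-1}$. *)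

(* Defs.v *)
From HB Require Import structures.
From mathcomp Require Import all_boot all_order all_algebra.
From mathcomp Require Import complex.
From mathcomp Require Import all_classical all_reals all_analysis.

Set Implicit Arguments.
Unset Strict Implicit.
Unset Printing Implicit Defensive.

Import Order.TTheory GRing.Theory Num.Theory.
Import numFieldNormedType.Exports.

Local Open Scope classical_set_scope.
Local Open Scope complex_scope.
Local Open Scope ring_scope.

Definition circle (R : realType) := {z : R[i] | `|z| == 1}.

Lemma circle1_subproof (R : realType) : `|1 : R[i]| == 1.
Proof. by rewrite normr1. Qed.

HB.instance Definition _ (R : realType) := Choice.on (circle R).
HB.instance Definition _ (R : realType) :=
  isPointed.Build (circle R) (exist _ 1 (circle1_subproof R)).

(* [open] is taken for the usual topology of the plane, which R[i] carries as
   a numFieldType. *)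
Definition circle_open (R : realType) : set (set (circle R)) :=
  [set (@sval R[i] _) @^-1` U | U in @open (R[i] : numFieldType)].

Definition borel_circle (R : realType) := g_sigma_algebraType (@circle_open R).

(* Charges are finite-valued signed measures, so a pair of them is exactly a
   complex measure. *)
Record complex_measure (R : realType) := ComplexMeasure {
  re_measure : {charge set (borel_circle R) -> \bar R} ;
  im_measure : {charge set (borel_circle R) -> \bar R} }.

Definition measure_value (R : realType) (nu : complex_measure R)
    (A : set (borel_circle R)) : R[i] :=
  fine (re_measure nu A) +i* fine (im_measure nu A).

(* x is in the support of nu iff no open neighbourhood of x is nu-null, i.e.
   null for the total variation of nu: all its Borel subsets have value 0. *)
Definition measure_support (R : realType) (nu : complex_measure R) :
    set (borel_circle R) :=
  [set x | forall V : set (borel_circle R), circle_open V -> V x ->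
    exists A, [/\ measurable A, A `<=` V & measure_value nu A != 0]].

Section charge_integral.
Context (d : measure_display) (T : measurableType d) (R : realType).
Variable nu : {charge set T -> \bar R}.

Definition hahn_pos : set T := projT1 (cid (Hahn_decomposition nu)).
Definition hahn_neg : set T :=
  projT1 (cid (projT2 (cid (Hahn_decomposition nu)))).
Definition hahn_posneg : hahn_decomposition nu hahn_pos hahn_neg :=
  projT2 (cid (projT2 (cid (Hahn_decomposition nu)))).

(* The Jordan decomposition does not depend on the chosen Hahn decomposition. *)
Definition charge_integral (f : T -> R) : R :=
  Rintegral (jordan_pos hahn_posneg) setT f -
  Rintegral (jordan_neg hahn_posneg) setT f.

End charge_integral.

Definition circle_integral (R : realType) (nu : complex_measure R)
    (f : R[i] -> R[i]) : R[i] :=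
  let u := fun x : borel_circle R => complex.Re (f (sval x)) in
  let v := fun x : borel_circle R => complex.Im (f (sval x)) in
  (charge_integral (re_measure nu) u - charge_integral (im_measure nu) v)
  +i* (charge_integral (re_measure nu) v + charge_integral (im_measure nu) u).

(* A matrix with rows in I and columns in J is a function I -> J -> K, which
   treats the index types nat and 'I_n alike. Entries of a product are finitely
   supported sums; they are junk only when infinitely many terms are nonzero. *)
Definition gmul (K : pzRingType) (I : Type) (J : choiceType) (H : Type)
    (A : I -> J -> K) (B : J -> H -> K) : I -> H -> K :=
  fun i h => \sum_(j \in [set: J]) A i j * B j h.

Definition gtr (K I J : Type) (A : I -> J -> K) : J -> I -> K := fun j i => A i j.

Definition gone (K : pzRingType) : nat -> nat -> K := fun i j => (i == j)%:R.

Definition ginverse (K : pzRingType) (A X : nat -> nat -> K) : Prop :=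
  gmul A X = gone K /\ gmul X A = gone K.

Definition lower_triangular (K : pzRingType) (A : nat -> nat -> K) : Prop :=
  forall i j : nat, (i < j)%N -> A i j = 0.

Definition upper_triangular (K : pzRingType) (A : nat -> nat -> K) : Prop :=
  forall i j : nat, (j < i)%N -> A i j = 0.

Definition nonzero_diagonal (K : pzRingType) (A : nat -> nat -> K) : Prop :=
  forall i : nat, A i i != 0.

(* Linv and Uinv are the (unique) two-sided inverses of L and U. *)
Definition gauss_borel (K : pzRingType) (M L Linv U Uinv : nat -> nat -> K) :
    Prop :=
  [/\ lower_triangular L /\ nonzero_diagonal L,
      upper_triangular U /\ nonzero_diagonal U,
      ginverse L Linv, ginverse U Uinv & M = gmul Linv Uinv].

Definition gcol (K I J : Type) (A : I -> J -> K) (j : J) : I -> 'I_1 -> K :=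
  fun i _ => A i j.

Definition grow (K I J : Type) (A : I -> J -> K) (i : I) : 'I_1 -> J -> K :=
  fun _ j => A i j.

Definition gscale (K : pzRingType) (I J : Type) (a : K) (A : I -> J -> K) :
    I -> J -> K :=
  fun i j => a * A i j.

Definition CMV_exponent (n : nat) : int :=
  if odd n then - (n./2.+1)%:Z else (n./2)%:Z.

Definition CMV_monomials (K : fieldType) (r : nat) (z : K) : nat -> 'I_r -> K :=
  fun i b => if (i %% r)%N == b then z ^ CMV_exponent (i %/ r) else 0.

Section perturbation.
Context (K : fieldType) (q d : nat).
Variables (c : 'I_q -> K) (zeta : 'I_q -> 'I_(2 * d) -> K).

(* z^d W_b(z), so that the coefficient of z^(k - d) in the Laurent polynomial
   W_b is the coefficient of z^k here; see WvalE. *)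
Definition Wnum (b : 'I_q) : {poly K} :=
  c b *: \prod_(l < 2 * d) ('X - (zeta b l)%:P).

Definition Wval (b : 'I_q) (z : K) : K :=
  c b * z ^- d * \prod_(l < 2 * d) (z - zeta b l).

Lemma WvalE b z : Wval b z = z ^- d * (Wnum b).[z].
Proof.
rewrite /Wval /Wnum hornerZ horner_prod [c b * _]mulrC -mulrA.
by congr (_ * (_ * _)); apply: eq_bigr => l _; rewrite hornerXsubC.
Qed.

Definition Wdiag (z : K) : 'I_q -> 'I_q -> K :=
  fun b b' => if b == b' then Wval b z else 0.

Definition Upsilon_block (m n : nat) : bool :=
  [|| ~~ odd m && (n == m.+2), (m == 1) && (n == 0) |
      [&& odd m, (2 < m)%N & (n.+2 == m)]].

Definition Upsilon : nat -> nat -> K := fun i j =>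
  (((i %% q)%N == (j %% q)%N) && Upsilon_block (i %/ q) (j %/ q))%:R.

(* The inverse of the permutation matrix Upsilon is its transpose, see
   Upsilon_inverse. *)
Definition Upsilon_pow (k : int) : nat -> nat -> K :=
  match k with
  | Posz n => iter n (gmul Upsilon) (gone K)
  | Negz n => iter n.+1 (gmul (gtr Upsilon)) (gone K)
  end.

Definition I_sel (b : 'I_q) : nat -> nat -> K :=
  fun i j => ((i == j) && ((i %% q)%N == b))%:R.

(* The sum over b of the W_b (Upsilon^(b)). *)
Definition Wop : nat -> nat -> K := fun i j =>
  \sum_(b < q) \sum_(k < (2 * d).+1)
     (Wnum b)`_k * gmul (Upsilon_pow (k%:Z - d%:Z)) (I_sel b) i j.

End perturbation.

Definition block_succ (m : nat) : nat :=
  if odd m then if m == 1 then 0 else m.-2 else m.+2.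

Definition block_pred (m : nat) : nat :=
  if odd m then m.+2 else if m == 0 then 1 else m.-2.

Lemma Upsilon_blockE m n : Upsilon_block m n = (n == block_succ m).
Proof.
rewrite /Upsilon_block /block_succ; case: m => [|[|[|m]]] //=.
- exact: orbF.
- exact: orbF.
- exact: orbF.
by rewrite !negbK; case: (odd m) => //=; rewrite ?orbF.
Qed.

Lemma block_succK : cancel block_succ block_pred.
Proof.
move=> [|[|[|m]]] //; rewrite /block_succ /block_pred /= ?negbK.
by case om: (odd m) => /=; rewrite ?om //= negbK om.
Qed.

Lemma block_predK : cancel block_pred block_succ.
Proof.
move=> [|[|[|m]]] //; rewrite /block_succ /block_pred /= ?negbK.
by case om: (odd m) => /=; rewrite ?negbK om.
Qed.

Definition lift_block (q : nat) (f : nat -> nat) (i : nat) : nat :=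
  (f (i %/ q) * q + i %% q)%N.

Lemma lift_block_div q f i : (0 < q)%N ->
  (lift_block q f i %/ q)%N = f (i %/ q)%N.
Proof.
move=> q0; rewrite /lift_block divnMDl //.
by rewrite (divn_small (ltn_pmod i q0)) addn0.
Qed.

Lemma lift_block_mod q f i : (lift_block q f i %% q)%N = (i %% q)%N.
Proof. by rewrite /lift_block modnMDl modn_mod. Qed.

Lemma lift_blockK q f g : (0 < q)%N -> cancel f g ->
  cancel (lift_block q f) (lift_block q g).
Proof.
move=> q0 fK i; rewrite {1}/lift_block lift_block_div // lift_block_mod fK.
by rewrite -divn_eq.
Qed.

Lemma UpsilonE (K : fieldType) q i j : (0 < q)%N ->
  Upsilon K q i j = (j == lift_block q block_succ i)%:R.
Proof.
move=> q0; rewrite /Upsilon Upsilon_blockE; congr (_%:R); congr nat_of_bool.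
apply/andP/eqP => [[/eqP im /eqP jd]|->].
  by rewrite /lift_block im -jd -divn_eq.
by rewrite lift_block_div // lift_block_mod !eqxx.
Qed.

Lemma gmul_perm (K : fieldType) (s : nat -> nat) (A B : nat -> nat -> K) :
  (forall i k, A i k = (k == s i)%:R) -> forall i j, gmul A B i j = B (s i) j.
Proof.
move=> AE i j; rewrite /gmul -(fsbig_widen [set s i]) //=; last first.
  by move=> k /= [_ ki]; rewrite AE; case: eqP => // _; rewrite mul0r.
by rewrite fsbig_set1 AE eqxx mul1r.
Qed.

Lemma Upsilon_inverse (K : fieldType) q : (0 < q)%N ->
  ginverse (Upsilon K q) (gtr (Upsilon K q)).
Proof.
move=> q0; have UE i j := UpsilonE K i j q0.
have sK := lift_blockK q0 block_succK; have tK := lift_blockK q0 block_predK.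
split; apply/funext => i; apply/funext => j; rewrite /gone.
  by rewrite (gmul_perm _ UE) /gtr UE (can_eq sK).
rewrite (@gmul_perm _ (lift_block q block_pred)) => [|k l].
  by rewrite UE tK eq_sym.
by rewrite /gtr UE -(can_eq tK) sK eq_sym.
Qed.

(* Entrywise integral of the matrix F(z) dmu(z) G(z). *)
Definition matrix_integral (R : realType) (p q : nat)
    (F : R[i] -> nat -> 'I_q -> R[i]) (mu : 'I_q -> 'I_p -> complex_measure R)
    (G : R[i] -> 'I_p -> nat -> R[i]) : nat -> nat -> R[i] := fun i j =>
  \sum_(b < q) \sum_(a < p)
    circle_integral (mu b a) (fun z => F z i b * G z a j).

(* Main.v *)
(* Integration is linear on Laurent polynomials, which are bounded and
   measurable on the circle, and Wop acts on the CMV monomials by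
   Wop Z(z) = Z(z) W(z); hence Mhat = Wop M. Substituting the two Gauss-Borel
   factorizations gives Uhat^-1 U = Lhat Wop L^-1, and the connection formulas
   are obtained by multiplying either expression of NC by B or by Ahat.
   Products of semi-infinite matrices are associative only under row or column
   finiteness, so each regrouping rests on triangularity or on the bandedness
   of Wop. *)
Require Import Defs.
From HB Require Import structures.
From mathcomp Require Import all_boot all_order all_algebra.
From mathcomp Require Import complex.
From mathcomp Require Import all_classical all_reals all_analysis.
From mathcomp Require Import measurable_realfun zify ring.

Set Implicit Arguments.
Unset Strict Implicit.
Unset Printing Implicit Defensive.

Import Order.TTheory GRing.Theory Num.Theory.
Import numFieldNormedType.Exports.

Local Open Scope classical_set_scope.
Local Open Scope complex_scope.
Local Open Scope ring_scope.

(** * Products of semi-infinite matrices *)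

Definition row_finite (K : pzRingType) (I J : Type) (A : I -> J -> K) : Prop :=
  forall i, finite_set [set j | A i j != 0].

Definition col_finite (K : pzRingType) (I J : Type) (A : I -> J -> K) : Prop :=
  forall j, finite_set [set i | A i j != 0].

Lemma not_mem_support (K : pzRingType) (I : Type) (f : I -> K) i :
  ~ [set j | f j != 0] i -> f i = 0.
Proof. by move=> /negP/negPn/eqP. Qed.

Lemma fsum_restrict (K : pzRingType) (J : choiceType) (D : set J) (f : J -> K) :
  (forall j, ~ D j -> f j = 0) ->
  \sum_(j \in [set: J]) f j = \sum_(j \in D) f j.
Proof. by move=> f0; apply/esym/fsbig_widen => // j [_ /f0]. Qed.

Section associativity.
Context (K : idomainType) (I : Type) (J H : choiceType) (G : Type).
Implicit Types (A : I -> J -> K) (B : J -> H -> K) (C : H -> G -> K).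

(** Both iterated sums reduce to the finite rectangle [D] x [E], where the order of summation can be
    exchanged. The disjunctions treat indices outside it: either the outer factor vanishes, whatever
    default value the inner sum takes, or every term of the inner sum vanishes. *)
Lemma gmulA_on A B C i g (D : set J) (E : set H) :
  finite_set D -> finite_set E ->
  (forall j h, ~ D j -> E h -> A i j * B j h = 0) ->
  (forall j h, D j -> ~ E h -> B j h * C h g = 0) ->
  (forall j, ~ D j -> A i j = 0 \/ forall h, B j h * C h g = 0) ->
  (forall h, ~ E h -> C h g = 0 \/ forall j, A i j * B j h = 0) ->
  gmul (gmul A B) C i g = gmul A (gmul B C) i g.
Proof.
move=> fD fE AB0 BC0 A0 C0; rewrite /gmul.
rewrite [LHS](@fsum_restrict _ _ E); last first.
  by move=> h /C0[->|AB]; rewrite ?mulr0// fsbig1 ?mul0r.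
rewrite [RHS](@fsum_restrict _ _ D); last first.
  by move=> j /A0[->|BC]; rewrite ?mul0r// fsbig1 ?mulr0.
transitivity (\sum_(h \in E) \sum_(j \in D) A i j * B j h * C h g).
  apply: eq_fsbigr => h /set_mem Eh; rewrite -mulr_fsuml (@fsum_restrict _ _ D)//.
  by move=> j Dj; exact: AB0.
rewrite exchange_fsbig//; apply: eq_fsbigr => j /set_mem Dj.
rewrite (@fsum_restrict _ _ E); last by move=> h Eh; exact: BC0.
by rewrite mulr_fsumr; apply: eq_fsbigr => h _; rewrite mulrA.
Qed.

(** The rectangle consists of the support of row [i] of [A] and the union of the supports of the
    rows of [B] indexed by it; [C] is arbitrary. *)
Lemma gmulA_row A B C : row_finite A -> row_finite B ->
  gmul (gmul A B) C = gmul A (gmul B C).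
Proof.
move=> fA fB; apply/funext => i; apply/funext => g.
have AB0 j : ~ [set j | A i j != 0] j -> A i j = 0 by exact: not_mem_support.
have BE h : ~ (\bigcup_(j in [set j | A i j != 0]) [set h | B j h != 0]) h ->
    forall j, A i j != 0 -> B j h = 0.
  by move=> nh j Aj; apply: contra_notP nh => /eqP Bj; exists j.
apply: (@gmulA_on _ _ _ _ _ [set j | A i j != 0]
  (\bigcup_(j in [set j | A i j != 0]) [set h | B j h != 0])) => //.
- by apply: bigcup_finite.
- by move=> j h /AB0 -> _; rewrite mul0r.
- by move=> j h Aj /BE ->//; rewrite mul0r.
- by move=> j /AB0; left.
- move=> h /BE B0; right => j.
  by have [->|/B0 ->] := eqVneq (A i j) 0; rewrite ?mul0r ?mulr0.
Qed.

Lemma gmulA_col A B C : col_finite B -> col_finite C ->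
  gmul (gmul A B) C = gmul A (gmul B C).
Proof.
move=> fB fC; apply/funext => i; apply/funext => g.
have C0 h : ~ [set h | C h g != 0] h -> C h g = 0.
  exact: (@not_mem_support _ _ (C^~ g)).
have BD j : ~ (\bigcup_(h in [set h | C h g != 0]) [set j | B j h != 0]) j ->
    forall h, C h g != 0 -> B j h = 0.
  by move=> nj h Ch; apply: contra_notP nj => /eqP Bj; exists h.
apply: (@gmulA_on _ _ _ _ _
  (\bigcup_(h in [set h | C h g != 0]) [set j | B j h != 0])
  [set h | C h g != 0]) => //.
- by apply: bigcup_finite.
- by move=> j h /BD B0 /B0 ->; rewrite mulr0.
- by move=> j h _ /C0 ->; rewrite mulr0.
- move=> j /BD B0; right => h.
  by have [->|/B0 ->] := eqVneq (C h g) 0; rewrite ?mul0r ?mulr0.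
- by move=> h /C0; left.
Qed.

(** This form lets the middle factor be arbitrary, as required when a moment matrix stands between a
    left and a right factor. *)
Lemma gmulA_row_col A B C : row_finite A -> col_finite C ->
  gmul (gmul A B) C = gmul A (gmul B C).
Proof.
move=> fA fC; apply/funext => i; apply/funext => g.
have A0 j : ~ [set j | A i j != 0] j -> A i j = 0 by exact: not_mem_support.
have C0 h : ~ [set h | C h g != 0] h -> C h g = 0.
  exact: (@not_mem_support _ _ (C^~ g)).
apply: (@gmulA_on _ _ _ _ _ [set j | A i j != 0] [set h | C h g != 0]) => //.
- by move=> j h /A0 ->; rewrite mul0r.
- by move=> j h _ /C0 ->; rewrite mulr0.
- by move=> j /A0; left.
- by move=> h /C0; left.
Qed.

Lemma row_finite_gmul A B : row_finite A -> row_finite B ->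
  row_finite (gmul A B).
Proof.
move=> fA fB i; apply: (@sub_finite_set _ _
  (\bigcup_(j in [set j | A i j != 0]) [set h | B j h != 0])).
  move=> h /=; apply: contraPP => nh; apply/negP; rewrite negbK.
  rewrite /gmul fsbig1// => j _.
  have [->|Aj] := eqVneq (A i j) 0; first by rewrite mul0r.
  have [->|Bj] := eqVneq (B j h) 0; first by rewrite mulr0.
  by exfalso; apply: nh; exists j.
exact: bigcup_finite.
Qed.

Lemma col_finite_gmul B C : col_finite B -> col_finite C ->
  col_finite (gmul B C).
Proof.
move=> fB fC g; apply: (@sub_finite_set _ _
  (\bigcup_(h in [set h | C h g != 0]) [set j | B j h != 0])).
  move=> j /=; apply: contraPP => nh; apply/negP; rewrite negbK.
  rewrite /gmul fsbig1// => h _.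
  have [->|Aj] := eqVneq (C h g) 0; first by rewrite mulr0.
  have [->|Bj] := eqVneq (B j h) 0; first by rewrite mul0r.
  by exfalso; apply: nh; exists h.
exact: bigcup_finite.
Qed.

End associativity.

(** * Triangular matrices and their inverses *)

Section triangular.
Context (K : idomainType).
Implicit Types A X L U : nat -> nat -> K.

Lemma gmul1 (H : Type) (B : nat -> H -> K) : gmul (gone K) B = B.
Proof.
apply/funext => i; apply/funext => h; rewrite /gmul (@fsum_restrict _ _ [set i]).
  by rewrite fsbig_set1 /gone eqxx mul1r.
by move=> j /= ji; rewrite /gone; case: eqP => [/esym|]; rewrite ?mul0r.
Qed.

Lemma gmulr1 (I : Type) (B : I -> nat -> K) : gmul B (gone K) = B.
Proof.
apply/funext => i; apply/funext => h; rewrite /gmul (@fsum_restrict _ _ [set h]).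
  by rewrite fsbig_set1 /gone eqxx mulr1.
by move=> j /= ji; rewrite /gone; case: eqP => //; rewrite mulr0.
Qed.

Lemma lower_triangular_row_finite A : lower_triangular A -> row_finite A.
Proof.
move=> lA i; apply: (@sub_finite_set _ _ `I_i.+1) => // j /=.
by rewrite ltnS leqNgt; apply: contraNN => /lA ->.
Qed.

Lemma upper_triangular_col_finite A : upper_triangular A -> col_finite A.
Proof.
move=> uA j; apply: (@sub_finite_set _ _ `I_j.+1) => // i /=.
by rewrite ltnS leqNgt; apply: contraNN => /uA ->.
Qed.

(* Forward substitution: a right inverse suffices because the rows of L are
   finitely supported. *)
Lemma lower_triangular_inverse L X : lower_triangular L -> nonzero_diagonal L ->
  gmul L X = gone K -> lower_triangular X.
Proof.
move=> lL dL LX i; elim/ltn_ind: i => i IH j ij.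
have /(congr1 (fun A => A i j)) := LX.
rewrite /gmul (@fsum_restrict _ _ [set i]); last first.
  move=> k /= /eqP; rewrite neq_ltn => /orP[ki|ik]; last by rewrite lL// mul0r.
  by rewrite IH ?mulr0// (ltn_trans ki).
rewrite fsbig_set1 /gone (ltn_eqF ij) => /eqP.
by rewrite mulf_eq0 (negbTE (dL i)) => /eqP.
Qed.

(** Induction on the column: in entry (i, j) of [gmul X U] with j < i, terms k < j vanish by
    induction and terms k > j by triangularity, so X i j * U j j = 0. *)
Lemma upper_triangular_inverse U X : upper_triangular U -> nonzero_diagonal U ->
  gmul X U = gone K -> upper_triangular X.
Proof.
move=> uU dU XU i j; elim/ltn_ind: j => j IH ji.
have /(congr1 (fun A => A i j)) := XU.
rewrite /gmul (@fsum_restrict _ _ [set j]); last first.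
  move=> k /= /eqP; rewrite neq_ltn => /orP[kj|jk]; last by rewrite uU// mulr0.
  by rewrite IH ?mul0r// (ltn_trans kj).
rewrite fsbig_set1 /gone (gtn_eqF ji) => /eqP.
by rewrite mulf_eq0 (negbTE (dU j)) orbF => /eqP.
Qed.

End triangular.

(** * The operator Wop *)

Section upsilon.
Context (K : fieldType) (q d : nat) (q_gt0 : (0 < q)%N).
Variables (c : 'I_q -> K) (zeta : 'I_q -> 'I_(2 * d) -> K).

(** The index permutation behind the k-th power of [Upsilon]. [Negz n] denotes -(n+1), hence [n.+1]
    backward steps. *)
Definition block_shift (k : int) : nat -> nat :=
  match k with
  | Posz n => iter n (lift_block q block_succ)
  | Negz n => iter n.+1 (lift_block q block_pred)
  end.

Lemma gtr_UpsilonE i j :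
  gtr (Upsilon K q) i j = (j == lift_block q block_pred i)%:R.
Proof.
have sK := lift_blockK q_gt0 block_succK; have tK := lift_blockK q_gt0 block_predK.
by rewrite /gtr UpsilonE// -(can_eq tK) sK eq_sym.
Qed.

Lemma iter_gmul_perm (s : nat -> nat) (A : nat -> nat -> K) n i j :
  (forall i k, A i k = (k == s i)%:R) ->
  iter n (gmul A) (gone K) i j = (j == iter n s i)%:R.
Proof.
move=> AE; elim: n i => [|n IH] i; first by rewrite /= /gone eq_sym.
by rewrite iterS (gmul_perm _ AE) IH iterSr.
Qed.

Lemma Upsilon_powE k i j :
  Upsilon_pow K q k i j = (j == block_shift k i)%:R.
Proof.
case: k => n.
  by apply: iter_gmul_perm => {}i {}j; exact: UpsilonE.
by apply: (iter_gmul_perm n.+1) => {}i {}j; exact: gtr_UpsilonE.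
Qed.

Lemma block_shift_mod k i : (block_shift k i %% q = i %% q)%N.
Proof.
have H f n : (iter n (lift_block q f) i %% q = i %% q)%N.
  by elim: n => // n IH; rewrite iterS lift_block_mod.
by case: k => n; exact: H.
Qed.

(** Listed as ..., 5, 3, 1, 0, 2, 4, ..., the blocks have consecutive exponents, and [block_succ]
    moves one place to the right. In terms of matrices, [Upsilon] multiplies Z(z) by z. *)
Lemma CMV_exponent_succ m : CMV_exponent (block_succ m) = CMV_exponent m + 1.
Proof.
rewrite /CMV_exponent /block_succ; case: m => [|[|[|m]]] //=.
by rewrite !negbK; case om: (odd m) => /=; rewrite ?om ?negbK ?om /=; lia.
Qed.

Lemma CMV_exponent_pred m : CMV_exponent (block_pred m) = CMV_exponent m - 1.
Proof. by rewrite -{2}(block_predK m) CMV_exponent_succ addrK. Qed.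

Lemma CMV_exponent_shift k i :
  CMV_exponent (block_shift k i %/ q) = CMV_exponent (i %/ q) + k.
Proof.
case: k => n; rewrite /block_shift.
  elim: n => [|n IH]; first by rewrite addr0.
  by rewrite iterS lift_block_div// CMV_exponent_succ IH; lia.
elim: n => [|n IH]; first by rewrite lift_block_div// CMV_exponent_pred.
by rewrite iterS lift_block_div// CMV_exponent_pred IH; lia.
Qed.

(** The component b to which row [i] belongs, that is, the only b for which [I_sel b] keeps index
    [i]. *)
Definition residue (i : nat) : 'I_q := Ordinal (ltn_pmod i q_gt0).

Lemma CMV_monomialsE r (z : K) i (b : 'I_r) :
  CMV_monomials z i b = ((i %% r)%N == b)%:R * z ^ CMV_exponent (i %/ r).
Proof. by rewrite /CMV_monomials; case: eqP; rewrite ?mul1r ?mul0r. Qed.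

(** Shifts preserve residues modulo q, so row [i] of [Wop] only involves the Laurent polynomial W_b
    with b the residue of [i]. *)
Lemma gmul_WopE (H : Type) (X : nat -> H -> K) i h :
  gmul (Wop c zeta) X i h = \sum_(k < (2 * d).+1)
    (Wnum c zeta (residue i))`_k * X (block_shift (k%:Z - d%:Z) i) h.
Proof.
have WE j : Wop c zeta i j = \sum_(k < (2 * d).+1)
    (Wnum c zeta (residue i))`_k * (j == block_shift (k%:Z - d%:Z) i)%:R.
  rewrite /Wop (bigD1 (residue i))//= [X in _ + X]big1 ?addr0.
    apply: eq_bigr => k _; congr (_ * _).
    rewrite (gmul_perm _ (Upsilon_powE _)) /I_sel block_shift_mod eqxx andbT.
    by rewrite eq_sym.
  move=> b bi; rewrite big1// => k _.
  rewrite (gmul_perm _ (Upsilon_powE _)) /I_sel block_shift_mod.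
  rewrite (_ : (i %% q)%N == b = false) ?andbF ?mulr0//.
  by apply: contraNF bi => /eqP bi; apply/eqP/val_inj.
(* The columns where row [i] of [Wop] may be nonzero, without repetition, so that each k is
   collected at exactly one column after the sums are exchanged. *)
pose s := undup [seq block_shift (k%:Z - d%:Z) i | k : 'I_(2 * d).+1].
have ks (k : 'I_(2 * d).+1) : block_shift (k%:Z - d%:Z) i \in s.
  by rewrite mem_undup; apply: map_f; rewrite mem_enum.
rewrite /gmul (@fsum_restrict _ _ [set` s]); last first.
  move=> j /= js; rewrite WE big1 ?mul0r// => k _.
  by case: eqP js => [->|_ _]; rewrite ?ks ?mulr0.
rewrite -fsbig_seq ?undup_uniq//.
under eq_bigr do rewrite WE mulr_suml.
rewrite exchange_big/=; apply: eq_bigr => k _.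
rewrite (bigD1_seq _ (ks k)) ?undup_uniq//= eqxx mulr1 big1 ?addr0// => j.
by move=> /negbTE ->; rewrite mulr0 mul0r.
Qed.

Lemma row_finite_Wop : row_finite (Wop c zeta).
Proof.
move=> i; apply: (@sub_finite_set _ _ (\bigcup_(k in [set: 'I_(2 * d).+1])
    [set block_shift (k%:Z - d%:Z) i])); last first.
  by apply: bigcup_finite => // k _; exact: finite_set1.
move=> j /=; apply: contraPP => nj; apply/negP; rewrite negbK.
(* The entries of [Wop] are read off its product with the identity. *)
rewrite -[Wop c zeta](@gmulr1 K) gmul_WopE big1// => k _.
rewrite /gone; case: eqP => [jk|]; last by rewrite mulr0.
by exfalso; apply: nj; exists k.
Qed.

(** Allows [Wnum] to be evaluated by summing over the same range of coefficients as in [Wop]. *)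
Lemma size_Wnum b : (size (Wnum c zeta b) <= (2 * d).+1)%N.
Proof.
apply: (leq_trans (size_scale_leq _ _)).
rewrite (eq_bigr (fun l => 'X - (zeta b l)%:P))//.
by rewrite -big_enum/= size_prod_XsubC size_enum_ord.
Qed.

Lemma gmul_Wop_CMV (z : K) : z != 0 ->
  gmul (Wop c zeta) (@CMV_monomials K q z) = gmul (CMV_monomials z) (Wdiag c zeta z).
Proof.
move=> z0; apply/funext => i; apply/funext => b.
transitivity (CMV_monomials z i b * Wval c zeta b z); last first.
  rewrite /gmul (@fsum_restrict _ _ [set b]); last first.
    by move=> j /= jb; rewrite /Wdiag; case: eqP => //; rewrite mulr0.
  by rewrite fsbig_set1 /Wdiag eqxx.
rewrite gmul_WopE CMV_monomialsE.
have [ib|ib] := eqVneq (i %% q)%N (b : nat); last first.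
  rewrite !mul0r big1// => k _.
  by rewrite CMV_monomialsE block_shift_mod (negbTE ib) mul0r mulr0.
have -> : residue i = b by apply: val_inj.
rewrite mul1r WvalE (horner_coef_wide _ (size_Wnum b)) !mulr_sumr.
apply: eq_bigr => k _.
rewrite CMV_monomialsE block_shift_mod ib eqxx mul1r CMV_exponent_shift.
(* Exponents with mixed signs add up because [z] is nonzero; the shift by -d is the factor z^-d of
   W_b. *)
rewrite !expfzDr// -exprnP -exprnN; ring.
Qed.

End upsilon.

(** * Integration on the circle *)

Section circle.
Context (R : realType).

Lemma open_Re_gt (a : R) :
  @open (R[i] : numFieldType) [set z | a < complex.Re z].
Proof.
rewrite openE => z /= az; apply/nbhs_ballP; exists (complex.Re z - a)%:C => /=.
  by rewrite ltcR subr_gt0.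
move=> w; rewrite -ball_normE /= => zw.
have : `|complex.Re (z - w)|%:C < (complex.Re z - a)%:C.
  exact: le_lt_trans (normc_ge_Re _) zw.
rewrite ltcR raddfB/= => /(le_lt_trans (ler_norm _)).
by rewrite ltrD2l ltrN2.
Qed.

(** Multiplication by i preserves the norm and turns the imaginary part into minus the real part. *)
Lemma normc_ge_Im (z : R[i]) : `|complex.Im z|%:C <= `|z|.
Proof.
have := normc_ge_Re (z * 'i%C).
by rewrite ReiNIm normrN normrM (_ : `|'i%C| = 1 :> R[i]) ?mulr1// complexiE normCi.
Qed.

Lemma open_Im_gt (a : R) :
  @open (R[i] : numFieldType) [set z | a < complex.Im z].
Proof.
rewrite openE => z /= az; apply/nbhs_ballP; exists (complex.Im z - a)%:C => /=.
  by rewrite ltcR subr_gt0.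
move=> w; rewrite -ball_normE /= => zw.
have : `|complex.Im (z - w)|%:C < (complex.Im z - a)%:C.
  exact: le_lt_trans (normc_ge_Im _) zw.
rewrite ltcR raddfB/= => /(le_lt_trans (ler_norm _)).
by rewrite ltrD2l ltrN2.
Qed.

(** Open right rays generate the Borel sets of the line, and their preimages here are traces of open
    plane sets, which generate the sigma-algebra of the circle. *)
Lemma measurable_circle (f : R[i] -> R) :
  (forall a, @open (R[i] : numFieldType) [set z | a < f z]) ->
  measurable_fun setT (fun x : borel_circle R => f (sval x)).
Proof.
move=> f_open; apply: (measurability _ (RGenOInfty.measurableE R)).
move=> _ [_ [a ->] <-]; rewrite setTI.
apply: sub_sigma_algebra; exists [set z | a < f z] => //.
by apply/seteqP; split => x /=; rewrite in_itv/= andbT.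
Qed.

(** A class closed under sums and products and containing the integer powers of z. Its real and
    imaginary parts are integrable for the finite Jordan parts of any charge. *)
Definition circle_bounded_measurable (f : R[i] -> R[i]) : Prop :=
  [/\ measurable_fun setT (fun x : borel_circle R => complex.Re (f (sval x))),
      measurable_fun setT (fun x : borel_circle R => complex.Im (f (sval x))) &
      exists M : R, forall x : circle R, `|f (sval x)| <= M%:C].

Lemma circle_bounded_measurableM f g :
  circle_bounded_measurable f -> circle_bounded_measurable g ->
  circle_bounded_measurable (fun z => f z * g z).
Proof.
move=> [fr fi [M fM]] [gr gi [N gN]]; split.
- rewrite (_ : (fun _ => _) = (fun x : borel_circle R =>
    complex.Re (f (sval x)) * complex.Re (g (sval x)) -
    complex.Im (f (sval x)) * complex.Im (g (sval x)))).
    by apply: measurable_funB; exact: measurable_funM.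
  by apply/funext => x; case: (f _) => a b; case: (g _).
- rewrite (_ : (fun _ => _) = (fun x : borel_circle R =>
    complex.Re (f (sval x)) * complex.Im (g (sval x)) +
    complex.Im (f (sval x)) * complex.Re (g (sval x)))).
    by apply: measurable_funD; exact: measurable_funM.
  by apply/funext => x; case: (f _) => a b; case: (g _).
- exists (M * N) => x; rewrite normrM rmorphM.
  by apply: ler_pM.
Qed.

Lemma circle_bounded_measurableD f g :
  circle_bounded_measurable f -> circle_bounded_measurable g ->
  circle_bounded_measurable (fun z => f z + g z).
Proof.
move=> [fr fi [M fM]] [gr gi [N gN]]; split.
- under eq_fun do rewrite raddfD; exact: measurable_funD.
- under eq_fun do rewrite raddfD; exact: measurable_funD.
- exists (M + N) => x; rewrite rmorphD.
  by apply: (le_trans (ler_normD _ _)); exact: lerD.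
Qed.

Lemma circle_bounded_measurable_cst a : circle_bounded_measurable (fun=> a).
Proof.
(* The norm of [a] lives in R[i], so its real part is taken to obtain a real bound. *)
split; [exact: measurable_cst..|exists (complex.Re `|a|) => x].
by rewrite RRe_real// normr_real.
Qed.

Lemma circle_bounded_measurable_sum (I : Type) (r : seq I) (f : I -> R[i] -> R[i]) :
  (forall i, circle_bounded_measurable (f i)) ->
  circle_bounded_measurable (fun z => \sum_(i <- r) f i z).
Proof.
move=> mf; elim: r => [|i r IH].
  under eq_fun do rewrite big_nil; exact: circle_bounded_measurable_cst.
by under eq_fun do rewrite big_cons; exact: circle_bounded_measurableD.
Qed.

Lemma circle_bounded_measurable_id : circle_bounded_measurable id.
Proof.
split.
- exact: measurable_circle open_Re_gt.
- exact: measurable_circle open_Im_gt.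
- by exists 1 => -[z /= /eqP ->].
Qed.

Lemma circle_invE (x : circle R) : (sval x)^-1 = ((sval x)^*)%C.
Proof. by case: x => z /= /eqP z1; rewrite invc_norm z1 expr1n invr1 mul1r. Qed.

(** On the unit circle the inverse is the conjugate, so only the sign of the imaginary part
    changes. *)
Lemma circle_bounded_measurable_inv : circle_bounded_measurable GRing.inv.
Proof.
have [mre mim _] := circle_bounded_measurable_id; split.
- rewrite (_ : (fun _ => _) = (fun x : borel_circle R => complex.Re (sval x)))//.
  by apply/funext => x; rewrite circle_invE; case: (sval x).
- rewrite (_ : (fun _ => _) = (fun x : borel_circle R => - complex.Im (sval x))).
    exact: measurable_funN.
  by apply/funext => x; rewrite circle_invE; case: (sval x).
- by exists 1 => -[z /= /eqP z1]; rewrite normfV z1 invr1.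
Qed.

Lemma circle_bounded_measurable_exp f n : circle_bounded_measurable f ->
  circle_bounded_measurable (fun z => f z ^+ n).
Proof.
move=> mf; elim: n => [|n IH].
  under eq_fun do rewrite expr0; exact: circle_bounded_measurable_cst.
by under eq_fun do rewrite exprS; exact: circle_bounded_measurableM.
Qed.

Lemma circle_bounded_measurable_exprz n :
  circle_bounded_measurable (fun z => z ^ n).
Proof.
case: n => n; first exact: circle_bounded_measurable_exp circle_bounded_measurable_id.
under eq_fun do rewrite NegzE -exprnN -exprVn.
exact: circle_bounded_measurable_exp circle_bounded_measurable_inv.
Qed.

Lemma circle_bounded_measurable_CMV r i (b : 'I_r) :
  circle_bounded_measurable (fun z => CMV_monomials z i b).
Proof.
rewrite /CMV_monomials; case: eqP => _; last exact: circle_bounded_measurable_cst.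
exact: circle_bounded_measurable_exprz.
Qed.

Lemma circle_bounded_measurable_CMV_inv r i (b : 'I_r) :
  circle_bounded_measurable (fun z => CMV_monomials z^-1 i b).
Proof.
rewrite /CMV_monomials; case: eqP => _; last exact: circle_bounded_measurable_cst.
under eq_fun do rewrite exprz_inv.
exact: circle_bounded_measurable_exprz.
Qed.

(** Both Jordan parts are finite measures, for which bounded measurable functions are integrable;
    linearity passes to the difference. Real combinations of two functions cover additivity as well
    as multiplication by a complex scalar. *)
Lemma charge_integral_lin (d : measure_display) (T : measurableType d)
    (nu : {charge set T -> \bar R}) (f g : T -> R) (r s : R) :
  measurable_fun setT f -> [bounded f x | x in setT] ->
  measurable_fun setT g -> [bounded g x | x in setT] ->
  charge_integral nu (fun x => r * f x + s * g x) =
  r * charge_integral nu f + s * charge_integral nu g.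
Proof.
move=> mf bf mg bg.
have integrable_scale (m : {finite_measure set T -> \bar R}) (t : R) (h : T -> R) :
    measurable_fun setT h -> [bounded h x | x in setT] ->
    m.-integrable setT (EFin \o h) /\ m.-integrable setT (EFin \o (fun x => t * h x)).
  move=> mh bh; have ih : m.-integrable setT (EFin \o h).
    by apply: measurable_bounded_integrable => //; rewrite ltey_eq fin_num_measure.
  by split => //; exact: (integrableZl measurableT t ih).
have Rintegral_lin (m : {finite_measure set T -> \bar R}) :
    Rintegral m setT (fun x => r * f x + s * g x) =
    r * Rintegral m setT f + s * Rintegral m setT g.
  have [intf intrf] := integrable_scale m r f mf bf.
  have [intg intsg] := integrable_scale m s g mg bg.
  by rewrite RintegralD// !RintegralZl.
by rewrite /charge_integral !Rintegral_lin; ring.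
Qed.

Lemma circle_bounded_measurable_Re f : circle_bounded_measurable f ->
  [bounded complex.Re (f (sval x)) | x in [set: borel_circle R]].
Proof.
move=> [_ _ [M fM]]; exists M; split; first exact: num_real.
move=> N /ltW MN x _ /=; apply: le_trans MN.
by rewrite -lecR (le_trans (normc_ge_Re _) (fM x)).
Qed.

Lemma circle_bounded_measurable_Im f : circle_bounded_measurable f ->
  [bounded complex.Im (f (sval x)) | x in [set: borel_circle R]].
Proof.
move=> [_ _ [M fM]]; exists M; split; first exact: num_real.
move=> N /ltW MN x _ /=; apply: le_trans MN.
by rewrite -lecR (le_trans (normc_ge_Im _) (fM x)).
Qed.

Lemma circle_integralD (nu : complex_measure R) f g :
  circle_bounded_measurable f -> circle_bounded_measurable g ->
  circle_integral nu (fun z => f z + g z) =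
  circle_integral nu f + circle_integral nu g.
Proof.
move=> mf mg; have [fr fi _] := mf; have [gr gi _] := mg.
have bfr := circle_bounded_measurable_Re mf; have bfi := circle_bounded_measurable_Im mf.
have bgr := circle_bounded_measurable_Re mg; have bgi := circle_bounded_measurable_Im mg.
rewrite /circle_integral.
rewrite (_ : (fun x : borel_circle R => complex.Re (f (sval x) + g (sval x))) =
  (fun x => 1 * complex.Re (f (sval x)) + 1 * complex.Re (g (sval x)))); last first.
  by apply/funext => x; rewrite raddfD/= !mul1r.
rewrite (_ : (fun x : borel_circle R => complex.Im (f (sval x) + g (sval x))) =
  (fun x => 1 * complex.Im (f (sval x)) + 1 * complex.Im (g (sval x)))); last first.
  by apply/funext => x; rewrite raddfD/= !mul1r.
rewrite !charge_integral_lin//.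
by apply/eqP; rewrite eq_complex /=; apply/andP; split; apply/eqP; ring.
Qed.

Lemma circle_integralZl (nu : complex_measure R) a f :
  circle_bounded_measurable f ->
  circle_integral nu (fun z => a * f z) = a * circle_integral nu f.
Proof.
move=> mf; have [fr fi _] := mf.
have bfr := circle_bounded_measurable_Re mf; have bfi := circle_bounded_measurable_Im mf.
case: a => ar ai; rewrite /circle_integral.
rewrite (_ : (fun x : borel_circle R => complex.Re ((ar +i* ai) * f (sval x))) =
  (fun x => ar * complex.Re (f (sval x)) + - ai * complex.Im (f (sval x)))); last first.
  by apply/funext => x; case: (f _) => u v /=; rewrite mulNr.
rewrite (_ : (fun x : borel_circle R => complex.Im ((ar +i* ai) * f (sval x))) =
  (fun x => ar * complex.Im (f (sval x)) + ai * complex.Re (f (sval x)))); last first.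
  by apply/funext => x; case: (f _) => u v.
rewrite !charge_integral_lin//.
by apply/eqP; rewrite eq_complex /=; apply/andP; split; apply/eqP; ring.
Qed.

Lemma circle_integral_sum (nu : complex_measure R) (I : Type) (r : seq I)
    (f : I -> R[i] -> R[i]) :
  (forall i, circle_bounded_measurable (f i)) ->
  circle_integral nu (fun z => \sum_(i <- r) f i z) =
  \sum_(i <- r) circle_integral nu (f i).
Proof.
move=> mf; elim: r => [|i r IH].
  (* The zero integrand is written as 0 * 0 so that homogeneity yields the value 0. *)
  rewrite big_nil; under eq_fun do rewrite big_nil -(mul0r 0).
  by rewrite circle_integralZl ?mul0r//; exact: circle_bounded_measurable_cst.
under eq_fun do rewrite big_cons.
by rewrite big_cons circle_integralD ?IH//; exact: circle_bounded_measurable_sum.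
Qed.

(** The circle avoids 0, so Laurent identities valid for nonzero z can be used under the
    integral. *)
Lemma eq_circle_integral (nu : complex_measure R) f g :
  (forall z, z != 0 -> f z = g z) -> circle_integral nu f = circle_integral nu g.
Proof.
move=> fg; have fgs (x : circle R) : f (sval x) = g (sval x).
  apply: fg; case: x => z /= z1; rewrite -normr_eq0 (eqP z1); exact: oner_neq0.
have fgc (h : R[i] -> R) : (fun x : borel_circle R => h (f (sval x))) =
    (fun x => h (g (sval x))) by apply/funext => x; rewrite fgs.
by rewrite /circle_integral !(fgc (@complex.Re R)) !(fgc (@complex.Im R)).
Qed.

End circle.

(** * The perturbed moment matrix and the connection formulas *)

Lemma matrix_integral_Wop (R : realType) (p q d : nat) (q_gt0 : (0 < q)%N)
    (mu : 'I_q -> 'I_p -> complex_measure R)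
    (c : 'I_q -> R[i]) (zeta : 'I_q -> 'I_(2 * d) -> R[i]) :
  matrix_integral
    (fun z => gmul (@CMV_monomials R[i] q z) (Wdiag c zeta z)) mu
    (fun z => gtr (CMV_monomials z^-1)) =
  gmul (Wop c zeta)
    (matrix_integral (@CMV_monomials R[i] q) mu
      (fun z => gtr (CMV_monomials z^-1))).
Proof.
(* Each entry on the right is now a finite combination of moments. Linearity brings it under the
   integral, where [gmul_Wop_CMV] identifies the integrands. *)
apply/funext => i; apply/funext => j; rewrite (gmul_WopE q_gt0).
rewrite /matrix_integral; under [RHS]eq_bigr do rewrite mulr_sumr.
rewrite [RHS]exchange_big/=; apply: eq_bigr => b _.
under [RHS]eq_bigr do rewrite mulr_sumr.
rewrite [RHS]exchange_big/=; apply: eq_bigr => a _.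
have mF k : circle_bounded_measurable (fun z =>
    CMV_monomials z (block_shift q k i) b * gtr (CMV_monomials z^-1) a j).
  apply: circle_bounded_measurableM; first exact: circle_bounded_measurable_CMV.
  exact: circle_bounded_measurable_CMV_inv.
under [RHS]eq_bigr do rewrite -circle_integralZl//.
rewrite -circle_integral_sum; last first.
  move=> k; apply: circle_bounded_measurableM => //.
  exact: circle_bounded_measurable_cst.
apply: eq_circle_integral => z z0.
rewrite -(gmul_Wop_CMV q_gt0)// gmul_WopE mulr_suml.
by apply: eq_bigr => k _; rewrite mulrA.
Qed.

Theorem proposition3p2 (R : realType) (p q d : nat)
    (p_gt0 : (0 < p)%N) (q_gt0 : (0 < q)%N) (d_gt0 : (0 < d)%N)
    (mu : 'I_q -> 'I_p -> complex_measure R)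
    (mu_inf : forall b a, infinite_set (measure_support (mu b a)))
    (c : 'I_q -> R[i]) (zeta : 'I_q -> 'I_(2 * d) -> R[i])
    (c_neq0 : forall b, c b != 0)
    (zeta_neq0 : forall b l, zeta b l != 0)
    (zeta_inj : injective (fun bl : 'I_q * 'I_(2 * d) => zeta bl.1 bl.2))
    (L Linv U Uinv Lhat Lhatinv Uhat Uhatinv : nat -> nat -> R[i]) :
  let Z r (z : R[i]) : nat -> 'I_r -> R[i] := CMV_monomials z in
  let W := Wdiag c zeta in
  let M := matrix_integral (Z q) mu (fun z => gtr (Z p z^-1)) in
  let Mhat :=
    matrix_integral (fun z => gmul (Z q z) (W z)) mu
      (fun z => gtr (Z p z^-1)) in
  gauss_borel M L Linv U Uinv ->
  gauss_borel Mhat Lhat Lhatinv Uhat Uhatinv ->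
  let B z := gmul L (Z q z) in
  (* [A z] and [Ahat z] are the paper's A(z^-1) and hat A(z^-1) *)
  let A z := gmul (gtr (Z p z^-1)) U in
  let Bhat z := gmul Lhat (Z q z) in
  let Ahat z := gmul (gtr (Z p z^-1)) Uhat in
  let NC := gmul Uhatinv U in
  NC = gmul (gmul Lhat (Wop c zeta)) Linv /\
  forall z : R[i], z != 0 ->
    [/\ gmul (Bhat z) (W z) = gmul NC (B z),
        forall b : 'I_q, Wval c zeta b z != 0 ->
          gcol (Bhat z) b = gscale (Wval c zeta b z)^-1 (gmul NC (gcol (B z) b)),
        gmul (Ahat z) NC = A z &
        forall a : 'I_p, gmul (grow (Ahat z) a) NC = grow (A z) a].
Proof.
move=> Z W M Mhat [[lL dL] [uU dU] [LLinv LinvL] [_ UinvU] ME].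
move=> [[lLh dLh] [uUh dUh] [LLhinv _] [UUhinv UhinvU] MhE] B A Bhat Ahat NC.
have rL := lower_triangular_row_finite lL.
have rLh := lower_triangular_row_finite lLh.
(* Inverses of the triangular factors inherit triangularity, hence finiteness of rows or columns. *)
have rLinv := lower_triangular_row_finite (lower_triangular_inverse lL dL LLinv).
have cU := upper_triangular_col_finite uU.
have cUh := upper_triangular_col_finite uUh.
have cUhinv := upper_triangular_col_finite (upper_triangular_inverse uUh dUh UhinvU).
have rW : row_finite (Wop c zeta) := row_finite_Wop q_gt0 c zeta.
have rLW := row_finite_gmul rLh rW.
have MU : gmul M U = Linv by rewrite ME gmulA_row_col// UinvU gmulr1.
have LMhat : gmul Lhat Mhat = Uhatinv.
  rewrite MhE -gmulA_row//; last first.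
    exact: lower_triangular_row_finite (lower_triangular_inverse lLh dLh LLhinv).
  by rewrite LLhinv gmul1.
(* Lhat Wop Linv = Lhat Wop (M U) = (Lhat Mhat) U = Uhat^-1 U, with [M] always between a row-finite
   and a column-finite factor. *)
have NCE : NC = gmul (gmul Lhat (Wop c zeta)) Linv.
  rewrite -MU -(gmulA_row_col _ rLW cU) (gmulA_row _ rLh rW).
  by rewrite -[gmul (Wop c zeta) M](matrix_integral_Wop q_gt0) LMhat.
split=> // z z0.
have Wcol : col_finite (W z) by move=> b; exact: finite_finset.
(* Lhat (Z W) = (Lhat Wop) Z = (Lhat Wop Linv) (L Z). The regrouping uses row finiteness of [NC],
   which is read off the form [NCE]. *)
have BW : gmul (Bhat z) (W z) = gmul NC (B z).
  rewrite /Bhat gmulA_row_col// -(gmul_Wop_CMV q_gt0)//.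
  rewrite -gmulA_row// /B -gmulA_row//; last first.
    by rewrite NCE; exact: row_finite_gmul.
  by rewrite NCE (gmulA_row _ rLW rLinv) LinvL gmulr1.
(* Here the form Uhat^-1 U of [NC] is the useful one: both factors are column-finite, and Uhat
   cancels against its inverse. *)
have AN : gmul (Ahat z) NC = A z.
  rewrite /Ahat gmulA_col//; last exact: col_finite_gmul.
  by rewrite /NC -(gmulA_col _ cUhinv cU) UUhinv gmul1.
split=> //.
- move=> b Wb; apply/funext => i; apply/funext => k.
  (* Since [W z] is diagonal, column b of the product is column b of [Bhat z] times W_b(z). *)
  have BWb : Bhat z i b * Wval c zeta b z = gmul NC (B z) i b.
    rewrite -BW [RHS]/gmul (@fsum_restrict _ _ [set b]).
      by rewrite fsbig_set1 /W /Wdiag eqxx.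
    by move=> b' /= bb; rewrite /W /Wdiag; case: eqP => //; rewrite mulr0.
  (* Extracting a column commutes with left multiplication by computation alone. *)
  rewrite /gcol /gscale [gmul NC _ _ _](_ : _ = gmul NC (B z) i b)// -BWb.
  by rewrite mulrCA mulVf ?mulr1.
- by move=> a; rewrite -AN.
Qed.
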